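(* Let $\mathcal{E}$ be a complex separable Hilbert space, let $k\ge 1$ be a natural number, and let $J_k$ be the truncated shift of index $k$ on $\mathcal{E}\otimes\mathbb{C}^k$. A closed subspace $\mathcal{M}$ of $\mathcal{E}\otimes\mathbb{C}^k$ is reducing for $J_k$ if and only if $\mathcal{M}=\mathcal{S}\otimes\mathbb{C}^k$ for some closed subspace $\mathcal{S}$ of $\mathcal{E}$.
   Context: $\mathcal{E}\otimes\mathbb{C}^k$ is identified with the direct sum $\mathcal{E}\oplus\cdots\oplus\mathcal{E}$ ($k$ copies), so that $\mathcal{S}\otimes\mathbb{C}^k=\mathcal{S}\oplus\cdots\oplus\mathcal{S}$ ($k$ copies). The truncated shift of index $k$ on $\mathcal{E}\otimes\mathbb{C}^k$ is $J_1=0$ for $k=1$, and $J_k(x_1,x_2,\ldots,x_k)=(0,x_1,\ldots,x_{k-1})$ for $k\ge 2$, $x_i\in\mathcal{E}$. A closed subspace $\mathcal{M}$ reduces a bounded operator $T$ if $T\mathcal{M}\subseteq\mathcal{M}$ and $T^*\mathcal{M}\subseteq\mathcal{M}$. *)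

(* Defs.v *)
From HB Require Import structures.
From mathcomp Require Import all_boot all_order all_algebra.
From mathcomp Require Import sesquilinear.
From mathcomp Require Import complex.
From mathcomp Require Import all_classical all_reals.
From mathcomp Require Import topology normedtype.

Set Implicit Arguments.
Unset Strict Implicit.
Unset Printing Implicit Defensive.

Import Order.TTheory GRing.Theory Num.Theory.
Import numFieldNormedType.Exports.

Local Open Scope classical_set_scope.
Local Open Scope ring_scope.

Section DotTheory.
Variables (C : numClosedFieldType) (U : lmodType C) (f : {dot U for Num.conj}).

Lemma dot_ge0 (u : U) : 0 <= f u u.
Proof.
have [->|u0] := eqVneq u 0; first by rewrite linear0l.
exact/ltW/neq0_dnorm_gt0.
Qed.

Lemma dotC (u v : U) : f u v = (f v u)^*.
Proof. by rewrite hermC expr0 mul1r. Qed.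

Lemma dot_CauchySchwarz (u v : U) : `|f u v| ^+ 2 <= f u u * f v v.
Proof.
have [->|v0] := eqVneq v 0; first by rewrite !linear0r normr0 expr0n mulr0.
have fv : 0 < f v v by exact: neq0_dnorm_gt0.
pose a := f u v / f v v; pose w := u - a *: v.
have wv : f w v = 0.
  by rewrite /w linearBl/= linearZl_LR/= divfK ?subrr// gt_eqF.
have fww : f w w = f u u - `|f u v| ^+ 2 / f v v.
  rewrite {2}/w linearBr/= linearZr_LR/= wv mulr0 subr0 /w linearBl/= linearZl_LR/=.
  by rewrite /a (dotC v u) normCK mulrAC.
by have := dot_ge0 w; rewrite fww subr_ge0 ler_pdivrMr.
Qed.

Lemma dot_triangle (u v : U) :
  sqrtC (f (u + v) (u + v)) <= sqrtC (f u u) + sqrtC (f v v).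
Proof.
have [[u0 v0] uv0] := (dot_ge0 u, dot_ge0 v, dot_ge0 (u + v)).
rewrite -ler_sqr ?nnegrE ?addr_ge0 ?sqrtC_ge0// sqrrD !sqrtCK.
rewrite linearDl/= !linearDr/= (dotC v u).
have -> : f u u + f u v + ((f u v)^* + f v v) =
          f u u + (f u v + (f u v)^*) + f v v by rewrite !addrA.
rewrite lerD2r lerD2l.
have zr : f u v + (f u v)^* \is Num.real.
  by apply/CrealP; rewrite rmorphD/= conjCK addrC.
apply: le_trans (real_ler_norm zr) _; apply: le_trans (ler_normD _ _) _.
rewrite norm_conjC -mulr2n lerMn2r/=.
by rewrite -ler_sqr ?nnegrE ?mulr_ge0 ?sqrtC_ge0// exprMn !sqrtCK dot_CauchySchwarz.
Qed.

End DotTheory.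

HB.mixin Record NormedModule_isHilbert (R : realType) E
    & NormedModule R[i] E := {
  hdot : {dot E for Num.conj} ;
  normr_hdot : forall x : E, `|x| ^+ 2 = hdot x x
}.

#[short(type="hilbertType")]
HB.structure Definition Hilbert (R : realType) :=
  {E of CompleteNormedModule R[i] E & NormedModule_isHilbert R E}.

Definition separable_space (T : topologicalType) :=
  exists2 D : set T, countable D & dense D.

Definition closed_subspace (K : numFieldType) (V : normedModType K)
  (M : set V) := closed M /\ submod_closed [in M].

Section Adjoint.
Variables (R : realType) (H : hilbertType R).

(* The value of the adjoint at y is the vector representing x |-> <T x, y>;
   it exists for bounded linear T by the Riesz representation theorem, and
   0 is the default value when there is none. *)
Definition adjoint (T : H -> H) (y : H) : H :=
  xget 0 [set z | forall x, hdot (T x) y = hdot x z].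

Lemma adjoint_unique (T S : H -> H) :
  (forall x y, hdot (T x) y = hdot x (S y)) -> adjoint T = S.
Proof.
move=> TS; apply/funext => y; rewrite /adjoint.
case: xgetP => [z _ /= zE|/(_ (S y))/=]; last by case; move=> x; rewrite TS.
have zS x : hdot x (z - S y) = 0 by rewrite linearBr/= -zE -TS subrr.
apply/eqP; rewrite -subr_eq0; apply/negPn/negP => n0.
have : 0 < hdot (z - S y) (z - S y) by exact: neq0_dnorm_gt0.
by rewrite zS ltxx.
Qed.

Definition reduces (M : set H) (T : H -> H) :=
  T @` M `<=` M /\ adjoint T @` M `<=` M.

End Adjoint.

(* E (x) C^k is the Hilbert space direct sum of k copies of E. *)
Definition dsum (E : Type) (k : nat) := 'I_k -> E.

Section DirectSum.
Variables (R : realType) (E : hilbertType R) (k : nat).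

HB.instance Definition _ := GRing.Lmodule.copy (dsum E k) ('I_k -> E).

Definition dsum_dot (x y : dsum E k) : R[i] := \sum_(i < k) hdot (x i) (y i).

Let dsum_dot_bilinear : bilinear_for
  (GRing.Scale.Law.clone _ _ *%R _)
  (GRing.Scale.Law.clone _ _ (Num.conj \; *%R) _) dsum_dot.
Proof.
split=> [y a x x'|x a y y']; rewrite /dsum_dot /= mulr_sumr -big_split/=;
  apply: eq_bigr => i _.
- by rewrite linearDl/= linearZl_LR.
- by rewrite linearDr/= linearZr_LR.
Qed.

HB.instance Definition _ := bilinear_isBilinear.Build R[i] (dsum E k) (dsum E k)
  R[i] _ _ dsum_dot dsum_dot_bilinear.

Let dsum_dot_hermitian (x y : dsum E k) :
  dsum_dot x y = (-1) ^+ false * Num.conj (dsum_dot y x).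
Proof.
rewrite expr0 mul1r /dsum_dot rmorph_sum; apply: eq_bigr => i _.
exact: dotC.
Qed.

HB.instance Definition _ := isHermitianSesquilinear.Build R[i] (dsum E k)
  false Num.conj dsum_dot dsum_dot_hermitian.

Let dsum_dot_gt0 (x : dsum E k) : x != 0 -> 0 < dsum_dot x x.
Proof.
move=> x0; rewrite lt_neqAle sumr_ge0 ?andbT => [|i _]; last exact: dot_ge0.
apply: contra x0; rewrite eq_sym psumr_eq0 => [/allP x0|i _]; last exact: dot_ge0.
apply/eqP/funext => i; apply/eqP/negPn/negP => xi0.
have : 0 < hdot (x i) (x i) by exact: neq0_dnorm_gt0.
by have /= := x0 i (mem_index_enum i) => /eqP ->; rewrite ltxx.
Qed.

HB.instance Definition _ :=
  isDotProduct.Build R[i] (dsum E k) dsum_dot dsum_dot_gt0.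

Definition dsum_norm (x : dsum E k) : R[i] := sqrtC (dsum_dot x x).

Let dsum_normD (x y : dsum E k) :
  dsum_norm (x + y) <= dsum_norm x + dsum_norm y.
Proof. exact: (dot_triangle dsum_dot). Qed.

Let dsum_normZ (a : R[i]) (x : dsum E k) :
  dsum_norm (a *: x) = `|a| * dsum_norm x.
Proof.
rewrite /dsum_norm linearZl_LR/= linearZr_LR/= mulrA -normCK.
by rewrite sqrtCM ?nnegrE ?exprn_ge0 ?(dot_ge0 dsum_dot)// sqrCK.
Qed.

Let dsum_norm0 (x : dsum E k) : dsum_norm x = 0 -> x = 0.
Proof.
move=> /eqP; rewrite sqrtC_eq0 => /eqP x0; apply/eqP/negPn/negP.
by move=> /dsum_dot_gt0; rewrite x0 ltxx.
Qed.

HB.instance Definition _ := Lmodule_isNormed.Build R[i] (dsum E k)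
  dsum_normD dsum_normZ dsum_norm0.

Lemma normr_dsum_dot (x : dsum E k) : `|x| ^+ 2 = dsum_dot x x.
Proof. exact: sqrtCK. Qed.

Lemma normr_dsum (x : dsum E k) : `|x| ^+ 2 = \sum_(i < k) `|x i| ^+ 2.
Proof.
by rewrite normr_dsum_dot; apply: eq_bigr => i _; rewrite normr_hdot.
Qed.

Lemma ler_norm_proj (x : dsum E k) (i : 'I_k) : `|x i| <= `|x|.
Proof.
rewrite -ler_sqr ?nnegrE// normr_dsum (bigD1 i)//= lerDl.
by rewrite sumr_ge0// => j _; rewrite exprn_ge0.
Qed.

Lemma ler_norm_sum_proj (x : dsum E k) : `|x| <= \sum_(i < k) `|x i|.
Proof.
rewrite -ler_sqr ?nnegrE ?sumr_ge0// normr_dsum expr2 mulr_suml.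
apply: ler_sum => i _; rewrite expr2 ler_wpM2l// (bigD1 i)//= lerDl.
by rewrite sumr_ge0.
Qed.

Let dsum_complete (F : set_system (dsum E k)) :
  ProperFilter F -> cauchy F -> cvg F.
Proof.
move=> FF /cauchy_ballP Fc.
have Fi i : cvg ((fun x : dsum E k => x i) @ F).
  apply: cauchy_cvg; apply/cauchy_ballP => e e0.
  rewrite near_simpl near_map2 near2E; apply: filterS (Fc e e0) => -[x y].
  rewrite -!ball_normE /=; apply: le_lt_trans.
  exact: (ler_norm_proj (x - y) i).
apply/cvg_ex.
pose l : dsum E k := fun i => lim ((fun x : dsum E k => x i) @ F).
exists l; apply/fcvgrPdist_lt => e e0.
have ek0 : 0 < e / k.+1%:R by rewrite divr_gt0.
have Fl : \forall x \near F, forall i, `|l i - x i| < e / k.+1%:R.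
  apply: filter_forall => i.
  by have /cvgrPdist_lt := Fi i; apply.
apply: filterS Fl => x xl; apply: le_lt_trans (ler_norm_sum_proj (l - x)) _.
apply: (@le_lt_trans _ _ (\sum_(i < k) e / k.+1%:R)).
  by apply: ler_sum => i _; exact/ltW/xl.
rewrite sumr_const card_ord -[ltLHS]mulr_natr mulrAC ltr_pdivrMr//.
by rewrite ltr_pM2l ?ltr_nat.
Qed.

HB.instance Definition _ := Uniform_isComplete.Build (dsum E k) dsum_complete.

HB.instance Definition _ :=
  NormedModule_isHilbert.Build R (dsum E k) normr_dsum_dot.

End DirectSum.

Section TruncatedShift.
Variables (R : realType) (E : hilbertType R) (k : nat).

(* S (x) C^k is the direct sum of k copies of S. *)
Definition dsum_set (S : set E) : set (dsum E k) :=
  [set x | forall i, S (x i)].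

Definition predI (i : 'I_k) : 'I_k :=
  Ordinal (leq_ltn_trans (leq_pred i) (ltn_ord i)).

(* With coordinates numbered from 0, the i-th coordinate of the image is
   x_(i-1) for i > 0 and 0 for i = 0; for k = 1 this is the zero operator. *)
Definition truncated_shift (x : dsum E k) : dsum E k :=
  fun i => if i == 0 :> nat then 0 else x (predI i).

Let truncated_shift_linear : linear truncated_shift.
Proof.
move=> a x y; apply/funext => i.
rewrite -[RHS]/(a *: truncated_shift x i + truncated_shift y i) /truncated_shift.
by case: ifP => // _; rewrite scaler0 addr0.
Qed.

HB.instance Definition _ := GRing.isLinear.Build R[i] (dsum E k) (dsum E k) _
  truncated_shift truncated_shift_linear.

End TruncatedShift.

Arguments dsum_set {R E} k S.
Arguments truncated_shift {R} E k x.

Lemma truncated_shift_norm (R : realType) (E : hilbertType R) (k : nat)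
  (x : dsum E k) : `|truncated_shift E k x| <= `|x|.
Proof.
rewrite -ler_sqr ?nnegrE// !normr_dsum.
case: k x => [|k] x; first by rewrite !big_ord0.
rewrite big_ord_recl big_ord_recr/= /truncated_shift/= normr0 expr0n add0r.
rewrite -[leLHS]addr0 lerD// ?exprn_ge0// le_eqVlt; apply/orP; left.
by apply/eqP/eq_bigr => i _; congr (`|x _| ^+ 2); exact/val_inj.
Qed.

Lemma truncated_shift_continuous (R : realType) (E : hilbertType R) (k : nat) :
  continuous (truncated_shift E k).
Proof.
apply: bounded_linear_continuous; apply/linear_boundedP.
near=> r => x; apply: le_trans (truncated_shift_norm x) _.
rewrite ler_peMl//; near: r; exact: nbhs_pinfty_ge.
Unshelve. all: by end_near. Qed.

(* Main.v *)
Require Import Defs.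
From HB Require Import structures.
From mathcomp Require Import all_boot all_order all_algebra.
From mathcomp Require Import complex.
From mathcomp Require Import all_classical all_reals.
From mathcomp Require Import topology normedtype.

Import Order.TTheory GRing.Theory Num.Theory.
Import numFieldNormedType.Exports.

Local Open Scope classical_set_scope.
Local Open Scope ring_scope.

(** The adjoint of J = J_k is the backward shift B, which drops the first
coordinate and appends 0. Both operators only move coordinates, up to the
vector 0, so a direct sum S (+) ... (+) S of copies of a subspace is reducing.

Conversely, words in J and B isolate the coordinates of a vector x: B^i brings
x_i to the front, J^(k-1) then pushes everything but that entry off the end,
and B^(k-1) brings the survivor back, so that
B^(k-1) J^(k-1) B^i x = (x_i, 0, ..., 0) ([isolate_coordinate]). On the other
hand x is recovered from these vectors as the sum of the
J^i (x_i, 0, ..., 0) ([sum_shifted_coordinates]). Hence, if M is reducing and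
S consists of the v with (v, 0, ..., 0) in M, then x lies in M if and only if
every x_i lies in S. As v |-> (v, 0, ..., 0) is linear and isometric, S is a
closed subspace. *)

Section Shifts.
Variables (R : realType) (E : hilbertType R) (k : nat).
Implicit Types (x y : dsum E k) (v : E).

(** Coordinates are indexed by all natural numbers, with value 0 past the end,
so that iterated shifts become plain arithmetic on indices. *)
Definition coord x (j : nat) : E := if insub j is Some i then x i else 0.

Lemma coord_ord x (i : 'I_k) : coord x i = x i.
Proof. by rewrite /coord valK. Qed.

Lemma coord_ge x j : (k <= j)%N -> coord x j = 0.
Proof. by move=> kj; rewrite /coord insubF// ltnNge kj. Qed.

Lemma dsum_coordP x y :
  (forall j, (j < k)%N -> coord x j = coord y j) -> x = y.
Proof.
by move=> xy; apply/funext => i; rewrite -!coord_ord; exact: xy.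
Qed.

Definition backward_shift x : dsum E k := fun i => coord x i.+1.

Lemma coord_backward_shift x j : coord (backward_shift x) j = coord x j.+1.
Proof.
have [kj|jk] := leqP k j; first by rewrite !coord_ge// leqW.
by rewrite -[LHS]/(coord _ (Ordinal jk)) coord_ord.
Qed.

Lemma coord_iter_backward_shift m x j :
  coord (iter m backward_shift x) j = coord x (j + m).
Proof.
elim: m j => [|m IHm] j; first by rewrite addn0.
by rewrite iterS coord_backward_shift IHm addSnnS.
Qed.

Lemma coord_truncated_shift x j :
  coord (truncated_shift E k x) j =
  if (0 < j < k)%N then coord x j.-1 else 0.
Proof.
have [kj|jk] := leqP k j; first by rewrite coord_ge// andbF.
rewrite -[LHS]/(coord _ (Ordinal jk)) coord_ord /truncated_shift /= andbT.
by case: posnP => // j0; rewrite -coord_ord.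
Qed.

Lemma coord_iter_truncated_shift m x j :
  coord (iter m (truncated_shift E k) x) j =
  if (m <= j < k)%N then coord x (j - m) else 0.
Proof.
elim: m j => [|m IHm] j /=.
  by rewrite subn0; case: ltnP => // /coord_ge ->.
rewrite coord_truncated_shift IHm; case: j => [|j] //=.
rewrite ltnS subSS; case: (ltnP j.+1 k) => [jk|_]; last by rewrite andbF.
by rewrite (ltnW jk).
Qed.

Definition first_summand v : dsum E k := fun i => if i == 0 :> nat then v else 0.

Lemma coord_first_summand v j :
  coord (first_summand v) j = if (j == 0) && (j < k)%N then v else 0.
Proof.
have [kj|jk] := leqP k j; first by rewrite coord_ge// andbF.
by rewrite -[LHS]/(coord _ (Ordinal jk)) coord_ord andbT.
Qed.

Let first_summand_linear : linear first_summand.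
Proof.
move=> a u v; apply/funext => i.
rewrite -[RHS]/(a *: first_summand u i + first_summand v i) /first_summand.
by case: ifP => // _; rewrite scaler0 addr0.
Qed.

HB.instance Definition _ :=
  GRing.isLinear.Build R[i] E (dsum E k) _ first_summand first_summand_linear.

Lemma first_summand_norm v : `|first_summand v| <= `|v|.
Proof.
apply: le_trans (ler_norm_sum_proj _) _; rewrite /first_summand.
case: k => [|n]; first by rewrite big_ord0.
by rewrite big_ord_recl big1 ?addr0// => i _; rewrite normr0.
Qed.

Lemma first_summand_continuous : continuous first_summand.
Proof.
apply: bounded_linear_continuous; apply/linear_boundedP.
near=> r => x; apply: le_trans (first_summand_norm x) _.
rewrite ler_peMl//; near: r; exact: nbhs_pinfty_ge.
Unshelve. all: by end_near. Qed.

(** J^(k-1) keeps only the first coordinate, which B^(k-1) restores to its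
place; applying B^i beforehand selects which coordinate that is. *)
Lemma isolate_coordinate x (i : 'I_k) :
  iter k.-1 backward_shift
    (iter k.-1 (truncated_shift E k) (iter i backward_shift x)) =
  first_summand (x i).
Proof.
apply: dsum_coordP => j jk; rewrite coord_first_summand jk andbT.
rewrite coord_iter_backward_shift coord_iter_truncated_shift leq_addl/=.
rewrite addnK coord_iter_backward_shift.
case: j jk => [|j] jk /=; first by rewrite prednK// add0n leqnn coord_ord.
by rewrite addSnnS (ltn_predK jk) ltnNge leq_addl.
Qed.

Lemma sum_shifted_coordinates x :
  x = \sum_(i < k) iter i (truncated_shift E k) (first_summand (x i)).
Proof.
apply/funext => l; rewrite fct_sumE (bigD1 l)//= big1 => [|i il].
  rewrite addr0 -[RHS]coord_ord coord_iter_truncated_shift leqnn ltn_ord/=.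
  by rewrite subnn coord_first_summand/= (leq_ltn_trans _ (ltn_ord l)).
rewrite -[LHS]coord_ord coord_iter_truncated_shift ltn_ord andbT.
case: leqP => // le_il; rewrite coord_first_summand subn_eq0 leqNgt.
by rewrite ltn_neqAle le_il andbT; move: il; rewrite -val_eqE/= => ->.
Qed.

End Shifts.

Arguments coord {R E k} x j.
Arguments backward_shift {R E k} x.
Arguments first_summand {R E} k v.

(** Both sides equal the sum of the <x_i, y_(i+1)>: the boundary terms vanish
because J x starts with 0 and B y ends with 0. *)
Lemma hdot_truncated_shift (R : realType) (E : hilbertType R) (k : nat)
    (x y : dsum E k) :
  hdot (truncated_shift E k x) y = hdot x (backward_shift y).
Proof.
rewrite -[LHS]/(dsum_dot _ _) -[RHS]/(dsum_dot _ _) /dsum_dot.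
case: k x y => [|n] x y; first by rewrite !big_ord0.
rewrite big_ord_recl big_ord_recr /= {1}/truncated_shift /= linear0l add0r.
rewrite {2}/backward_shift coord_ge// linear0r addr0.
apply: eq_bigr => i _; congr (hdot _ _); first by congr (x _); exact/val_inj.
by rewrite -[LHS]coord_ord.
Qed.

Lemma adjoint_truncated_shift (R : realType) (E : hilbertType R) (k : nat) :
  adjoint (truncated_shift E k) = @backward_shift R E k.
Proof. by apply: adjoint_unique => x y; exact: hdot_truncated_shift. Qed.

Lemma iter_stable (T : Type) (M : set T) (f : T -> T) n x :
  f @` M `<=` M -> M x -> M (iter n f x).
Proof. by move=> fM Mx; elim: n => // n IHn; apply: fM; exists (iter n f x). Qed.

Lemma closed_subspace0 (K : numFieldType) (V : normedModType K) (M : set V) :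
  closed_subspace M -> M 0.
Proof. by case=> _ [/set_mem]. Qed.

Lemma closed_subspace_sum (K : numFieldType) (V : normedModType K) (M : set V)
    (I : Type) (r : seq I) (F : I -> V) :
  closed_subspace M -> (forall i, M (F i)) -> M (\sum_(i <- r) F i).
Proof.
move=> Ms MF; elim/big_ind: _ => //; first exact: closed_subspace0.
case: Ms => _ [_ Mlin] u v Mu Mv.
by rewrite -[u]scale1r; apply/set_mem/Mlin; exact/mem_set.
Qed.

Lemma closed_subspace_preimage (K : numFieldType) (V W : normedModType K)
    (f : {linear V -> W}) (M : set W) :
  continuous f -> closed_subspace M -> closed_subspace (f @^-1` M).
Proof.
move=> fc Ms; split; first by apply: closed_comp => [v _|]; [exact: fc|case: Ms].
split; first by apply/mem_set; rewrite /= linear0; exact: closed_subspace0.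
move=> a u v /set_mem/= Mu /set_mem/= Mv; apply/mem_set.
by rewrite /= linearP; case: Ms => _ [_ Mlin]; apply/set_mem/Mlin; exact/mem_set.
Qed.

Lemma reduces_dsum_set (R : realType) (E : hilbertType R) (k : nat)
    (S : set E) : S 0 -> reduces (dsum_set k S) (truncated_shift E k).
Proof.
move=> S0; split=> _ [x Sx <-] i; first by rewrite /truncated_shift; case: ifP.
by rewrite adjoint_truncated_shift /backward_shift /coord; case: insub.
Qed.

(** The vectors (x_i, 0, ..., 0) and x itself are obtained from one another by
words in J and B and finite sums, all of which preserve M. *)
Lemma reduces_truncated_shift_eq (R : realType) (E : hilbertType R) (k : nat)
    (M : set (dsum E k)) :
  closed_subspace M -> reduces M (truncated_shift E k) ->
  M = dsum_set k (first_summand k @^-1` M).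
Proof.
move=> Ms [JM]; rewrite adjoint_truncated_shift => BM.
apply/seteqP; split=> x Mx => [i|].
  by rewrite /preimage/= -isolate_coordinate; do 3!apply: iter_stable => //.
rewrite [x]sum_shifted_coordinates; apply: closed_subspace_sum => // i.
by apply: iter_stable => //; exact: Mx.
Qed.

Theorem theorem3p1 (R : realType) (E : hilbertType R)
    (sepE : separable_space E) (k : nat) (k_ge1 : (1 <= k)%N)
    (M : set (dsum E k)) (clM : closed_subspace M) :
  reduces M (truncated_shift E k) <->
  exists2 S : set E, closed_subspace S & M = dsum_set k S.
Proof.
split=> [redM|[S Ss ->]].
  exists (first_summand k @^-1` M); last exact: reduces_truncated_shift_eq.
  by apply: closed_subspace_preimage => //; exact: first_summand_continuous.
by apply: reduces_dsum_set; exact: closed_subspace0.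
Qed.
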